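(* Let $n,a,b$ be positive integers with $a+b<n$ and $a\ge b+3$, and let $\sigma$ be a uniformly random permutation of $\{1,\ldots,n\}$. Then $\Pr[D_{a,b}(\sigma)=0]\le\frac1{n+1/2}=\frac1n-\frac1{n(2n+1)}$.
   Context: For positive integers $a,b$ with $a+b<n$ and a permutation $\sigma$ of $\{1,\ldots,n\}$, define $D_{a,b}(\sigma)=\sum_{i=1}^{a}\sigma(i)-\sum_{i=a+1}^{a+b}\sigma(i)$. *)

(* Defs.v *)
From mathcomp Require Import all_boot all_order all_algebra all_fingroup.

Set Implicit Arguments.
Unset Strict Implicit.
Unset Printing Implicit Defensive.

Import GRing.Theory Num.Theory.
Local Open Scope ring_scope.

Definition uniform_Pr (T : finType) (E : {set T}) : rat :=
  #|E|%:R / #|T|%:R.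

(* Positions and values are 0-based in 'I_n, hence the successor on values:
   the 1-based positions 1..a and a+1..a+b are i < a and a <= i < a + b, and
   the 1-based value at a position is (s i).+1. *)
Definition D (n a b : nat) (s : 'S_n) : int :=
  \sum_(i < n | (i < a)%N) Posz (s i).+1
  - \sum_(i < n | (a <= i < a + b)%N) Posz (s i).+1.

(* Main.v *)
Require Import Defs.
From mathcomp Require Import all_boot all_order all_algebra all_fingroup.
From mathcomp Require Import zify ring lra.

Import GRing.Theory Num.Theory.
Local Open Scope ring_scope.

(** Let [A], [B] be the first [a] and the next [b] positions, [p] a position in
    [B], [P] the rest of [B] and [Q] the positions outside [B].  Group the
    permutations into classes: [s] and [t] are in the same class when they agree
    on [P] and order the positions of [Q] in the same way.  There are
    [n! / (n - b + 1)] classes.  Inside a class, raising the value at [p] lowers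
    every value on [Q] weakly, and by the same amount in total; so if
    [s p <= t p], then [D s - D t] lies between [t p - s p] and
    [2 (t p - s p) <= 2 (n - 1)].  Since [2 (n - 1) < (a - b) (n + 1)], a class
    contains at most one permutation with [D] in [{0, (a - b) (n + 1)}].
    Reversing the values exchanges [D = 0] and [D = (a - b) (n + 1)], so
    [2 Pr[D = 0] <= 1 / (n - b + 1)], and [2 (n - b + 1) > n + 1/2] because
    [b < n / 2]. *)

Section Classes.

Variables (n : nat) (P : {set 'I_n}) (p : 'I_n).
Hypothesis pP : p \notin P.

Let Q := ~: (p |: P).

Lemma big_split_classes (R : Type) (idx : R) (op : Monoid.com_law idx)
    (F : 'I_n -> R) :
  \big[op/idx]_i F i =
  op (op (F p) (\big[op/idx]_(i in P) F i)) (\big[op/idx]_(i in Q) F i).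
Proof.
rewrite -big_setU1 //= (bigID (mem (p |: P))) /=; congr (op _ _).
by apply: eq_bigl => i; rewrite /Q in_setC.
Qed.

Definition rank_in (s : 'S_n) (q : 'I_n) : nat :=
  (\sum_(i in Q) (s i < s q))%N.

Definition same_class (s t : 'S_n) : Prop :=
  {in P, s =1 t} /\ {in Q, rank_in s =1 rank_in t}.

Lemma same_class_sym (s t : 'S_n) : same_class s t -> same_class t s.
Proof. by case=> eP eQ; split=> i iX; rewrite ?eP ?eQ. Qed.

(** If [s q < t q], compare how many positions have a value below [t q]. On [P] the counts agree,
    and at [p] the one for [s] is no smaller. On [Q] the count for [t] is the common rank of [q],
    which [s] exceeds because it also counts [q] itself. Yet both totals are equal. *)
Lemma same_class_anti (s t : 'S_n) :
  same_class s t -> (s p <= t p)%N -> {in Q, forall q, (t q <= s q)%N}.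
Proof.
case=> eP eQ le_p q qQ; rewrite leqNgt; apply/negP=> lt_q.
have cnt (u : 'S_n) : (\sum_i (u i < t q) = \sum_(i < n) (i < t q))%N.
  by rewrite [RHS](reindex_inj (@perm_inj _ u)).
have := etrans (cnt s) (esym (cnt t)).
rewrite !big_split_classes /=.
have -> : (\sum_(i in P) (s i < t q) = \sum_(i in P) (t i < t q))%N.
  by apply: eq_bigr => i /eP ->.
have := eQ q qQ; rewrite /rank_in => <-.
have lt_sum : (\sum_(i in Q) (s i < s q) < \sum_(i in Q) (s i < t q))%N.
  rewrite (bigD1 q) //= [ltnRHS](bigD1 q) //= ltnn lt_q add0n add1n ltnS.
  apply: leq_sum => i _; case: ltnP => // lt_i.
  by rewrite (ltn_trans lt_i lt_q).
have le_b : ((t p < t q) <= (s p < t q))%N.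
  by case: ltnP => // lt_t; rewrite (leq_ltn_trans le_p lt_t).
move: lt_sum le_b; do 3 move: (bigop _ _ _) => ?.
by do 2 move: (nat_of_bool _) => ?; lia.
Qed.

Lemma same_class_eq (s t : 'S_n) : same_class s t -> s p = t p -> s = t.
Proof.
move=> st e_p; have ts := same_class_sym _ _ st.
have le_st := same_class_anti _ _ st; have le_ts := same_class_anti _ _ ts.
rewrite e_p leqnn in le_st le_ts.
apply/permP=> i; have [iQ|] := boolP (i \in Q).
  by apply/val_inj/eqP; rewrite eqn_leq le_ts // le_st.
by rewrite /Q in_setC negbK in_setU1 => /orP[/eqP ->|/st.1].
Qed.

Lemma rank_in_lt (s : 'S_n) (q : 'I_n) : q \in Q -> (rank_in s q < #|Q|)%N.
Proof.
move=> qQ; rewrite /rank_in (bigD1 q) //= ltnn add0n (cardD1 q) qQ ltnS.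
rewrite -sum1_card (eq_bigl (fun i => (i \in Q) && (i != q))).
  by apply: leq_sum => i _; case: (_ < _)%N.
by move=> i; rewrite inE andbC.
Qed.

Lemma rank_in_inj (s : 'S_n) : {in Q &, injective (rank_in s)}.
Proof.
suff lt q q' : q \in Q -> (s q < s q')%N -> (rank_in s q < rank_in s q')%N.
  move=> q q' qQ q'Q e; apply: (@perm_inj _ s); apply/val_inj/eqP.
  by case: ltngtP => // /lt; rewrite e ltnn => ->.
move=> qQ lt_q; rewrite /rank_in (bigD1 q) //= [ltnRHS](bigD1 q) //=.
rewrite ltnn lt_q add0n add1n ltnS.
apply: leq_sum => i _; case: ltnP => // lt_i.
by rewrite (ltn_trans lt_i lt_q).
Qed.

(** Ranks are taken in ['I_#|Q|] so that both components are injections, counted by falling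
    factorials. *)
Definition class_code (s : 'S_n) :
    {ffun {i | i \in P} -> 'I_n} * {ffun {i | i \in Q} -> 'I_#|Q|} :=
  ([ffun i => s (val i)], [ffun q => Ordinal (rank_in_lt s _ (valP q))]).

Lemma class_code_same (s t : 'S_n) :
  class_code s = class_code t -> same_class s t.
Proof.
case=> /ffunP eP /ffunP eQ; split=> i iX.
  by have := eP (exist _ i iX); rewrite !ffunE.
by have := eQ (exist _ i iX); rewrite !ffunE => /(congr1 val).
Qed.

Lemma card_no_same_class (E : {set 'S_n}) :
  {in E &, forall s t, same_class s t -> s = t} ->
  (#|E| <= n ^_ #|P| * (#|Q|)`!)%N.
Proof.
move=> Einj; have code_inj : {in E &, injective class_code}.
  by move=> s t sE tE /class_code_same; apply: Einj.
rewrite -(card_in_imset code_inj) -ffactnn.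
have := card_inj_ffuns {i | i \in P} 'I_n.
have := card_inj_ffuns {i | i \in Q} 'I_#|Q|.
rewrite !card_ord !card_sig => <- <-; rewrite -cardsX.
apply/subset_leq_card/subsetP => _ /imsetP[s sE ->].
rewrite !inE /=; apply/andP; split; apply/injectiveP => x y; rewrite !ffunE.
  by move/perm_inj/val_inj.
by case=> /rank_in_inj e; apply/val_inj/e; exact: valP.
Qed.

(** The values of any permutation have the same total, so what [t] gains at [p] it loses on [Q]. *)
Lemma sum_sub_classes (s t : 'S_n) :
  {in P, s =1 t} ->
  \sum_(i in Q) (Posz (s i) - Posz (t i)) = Posz (t p) - Posz (s p).
Proof.
move=> eP; have tot (u : 'S_n) :
    Posz (u p) + \sum_(i in P) Posz (u i) + \sum_(i in Q) Posz (u i) =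
    \sum_(i < n) Posz i.
  by rewrite -big_split_classes [RHS](reindex_inj (@perm_inj _ u)).
have := etrans (tot s) (esym (tot t)); rewrite sumrB.
have -> : \sum_(i in P) Posz (s i) = \sum_(i in P) Posz (t i).
  by apply: eq_bigr => i /eP ->.
move: (\sum_(i in Q) Posz (s i)) (\sum_(i in Q) Posz (t i)).
by move: (\sum_(i in P) _) => z x y; lia.
Qed.

End Classes.

Definition sum_diff (n : nat) (A B : {set 'I_n}) (s : 'S_n) : int :=
  \sum_(i in A) Posz (s i).+1 - \sum_(i in B) Posz (s i).+1.

(** [P] cancels, [p] contributes [t p - s p], and [A] contributes some of the nonnegative decreases
    on [Q], whose total is again [t p - s p]. *)
Lemma sum_diff_same_class (n : nat) (A P : {set 'I_n}) (p : 'I_n)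
    (s t : 'S_n) :
  p \notin P -> [disjoint A & p |: P] -> same_class n P p s t ->
  (s p <= t p)%N ->
  Posz (t p) - Posz (s p) <=
    sum_diff n A (p |: P) s - sum_diff n A (p |: P) t
    <= (Posz (t p) - Posz (s p)) *+ 2.
Proof.
move=> pP dA st le_p.
have AQ i : i \in A -> i \in ~: (p |: P).
  by rewrite in_setC => /(disjointFr dA) ->.
have ge0 i : i \in ~: (p |: P) -> 0 <= Posz (s i) - Posz (t i).
  by move=> iQ; have := same_class_anti _ _ _ pP _ _ st le_p i iQ; lia.
have -> : sum_diff n A (p |: P) s - sum_diff n A (p |: P) t =
    \sum_(i in A) (Posz (s i) - Posz (t i)) + (Posz (t p) - Posz (s p)).
  rewrite /sum_diff !big_setU1 //=.
  have -> : \sum_(i in P) Posz (s i).+1 = \sum_(i in P) Posz (t i).+1.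
    by apply: eq_bigr => i /st.1 ->.
  have -> : \sum_(i in A) (Posz (s i) - Posz (t i)) =
      \sum_(i in A) Posz (s i).+1 - \sum_(i in A) Posz (t i).+1.
    by rewrite -sumrB; apply: eq_bigr => i _; lia.
  move: (\sum_(i in A) Posz (s i).+1) (\sum_(i in A) Posz (t i).+1).
  by move: (\sum_(i in P) _) => z x y; lia.
have sum_ge0 : 0 <= \sum_(i in A) (Posz (s i) - Posz (t i)).
  by apply: sumr_ge0 => i /AQ; apply: ge0.
have sum_le : \sum_(i in A) (Posz (s i) - Posz (t i)) <=
    Posz (t p) - Posz (s p).
  rewrite -(sum_sub_classes n P p pP s t st.1).
  rewrite [leRHS](big_setID A) /= (setIidPr _); last by apply/subsetP.
  rewrite lerDl; apply: sumr_ge0 => i /setDP[iQ _]; exact: ge0.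
by move: (\sum_(i in A) _) sum_ge0 sum_le => x; lia.
Qed.

Definition perm_rev (n : nat) : 'S_n := perm (@rev_ord_inj n).

Lemma sum_diff_rev (n : nat) (A B : {set 'I_n}) (s : 'S_n) :
  sum_diff n A B (s * perm_rev n)%g =
  (Posz #|A| - Posz #|B|) * Posz n.+1 - sum_diff n A B s.
Proof.
have sum_rev (X : {set 'I_n}) : \sum_(i in X) Posz ((s * perm_rev n)%g i).+1 =
    Posz #|X| * Posz n.+1 - \sum_(i in X) Posz (s i).+1.
  rewrite (eq_bigr (fun i => Posz n.+1 - Posz (s i).+1)).
    by rewrite sumrB sumr_const -mulr_natl natz.
  by move=> i _; rewrite permM permE /=; have := ltn_ord (s i); lia.
by rewrite /sum_diff !sum_rev; ring.
Qed.

Lemma card_sum_diff_eq0 (n : nat) (A B : {set 'I_n}) :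
  [disjoint A & B] -> (0 < #|B|)%N -> (#|B| + 2 <= #|A|)%N ->
  (#|[set s | sum_diff n A B s == 0%R]|.*2 * (n - #|B|).+1 <= n`!)%N.
Proof.
move=> dA /card_gt0P[p pB] leBA.
pose P := B :\ p; have pP : p \notin P by rewrite !inE eqxx.
have defB : B = p |: P by rewrite setD1K.
have cardB : #|B| = #|P|.+1 by rewrite (cardsD1 p B) pB.
have leBn : (#|B| <= n)%N by rewrite -[leqRHS]card_ord max_card.
pose M := (Posz #|A| - Posz #|B|) * Posz n.+1.
have M_gt : Posz n *+ 2 < M.
  by rewrite /M; nia.
pose E0 := [set s | sum_diff n A B s == 0].
pose E1 := [set s | sum_diff n A B s == M].
(* [E0] is the preimage of [E1] under composition with the reversal of values. *)
have card_E1 : #|E1| = #|E0|.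
  rewrite -(card_preimset E1 (@mulIg _ (perm_rev n))).
  by apply: eq_card => s; rewrite !inE sum_diff_rev -/M; lia.
have dE : [disjoint E0 & E1].
  rewrite disjoints_subset; apply/subsetP=> s; rewrite !inE => /eqP ->.
  by lia.
have leE : (#|E0 :|: E1| <= n ^_ #|P| * (#|~: (p |: P)|)`!)%N.
  apply: card_no_same_class => // s t sE tE st.
  wlog le_p : s t sE tE st / (s p <= t p)%N.
    move=> th; case: (leqP (s p) (t p)) => [|/ltnW] le_p; first exact: th.
    by apply/esym/th => //; exact: same_class_sym.
  apply: (same_class_eq _ _ _ pP _ _ st); apply: val_inj => /=.
  have dA' : [disjoint A & p |: P] by rewrite -defB.
  (* Both values of [sum_diff] are 0 or [M], and their difference is nonnegative and below [M]. So
     they are equal, and the lower bound forces [s p = t p]. *)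
  have := sum_diff_same_class _ _ _ _ _ _ pP dA' st le_p; rewrite -defB.
  have := ltn_ord (t p); move: sE tE; rewrite !inE.
  by lia.
have cQ : #|~: (p |: P)| = (n - #|B|)%N by rewrite -defB cardsCs setCK card_ord.
move: leE; rewrite cardsU disjoint_setI0 // cards0 subn0 card_E1 addnn cQ.
move=> leE; apply: leq_trans (leq_mul leE (leqnn _)) _.
(* The extra factor turns the factorial of [n - #|B|] into that of [n - #|P|], which completes the
   falling factorial to [n!]. *)
rewrite -mulnA [((_)`! * _)%N]mulnC -factS.
have -> : (n - #|B|).+1 = (n - #|P|)%N by lia.
by rewrite ffact_fact //; lia.
Qed.

Lemma card_ord_range (n a b : nat) : (a + b <= n)%N ->
  #|[set i : 'I_n | (a <= i < a + b)%N]| = b.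
Proof.
move=> le_n; transitivity (\sum_(a <= i < a + b) 1)%N; last first.
  by rewrite sum_nat_const_nat; lia.
rewrite -sum1dep_card (big_nat_widen _ _ _ _ _ le_n) big_geq_mkord /=.
by apply: eq_bigl => i; rewrite andbC.
Qed.

Theorem theorem11 (n a b : nat)
    (hn : (0 < n)%N) (ha : (0 < a)%N) (hb : (0 < b)%N)
    (habn : (a + b < n)%N) (hab : (b + 3 <= a)%N) :
  uniform_Pr [set s : 'S_n | D a b s == 0] <= 1 / (n%:R + 1 / 2%:R) /\
  1 / (n%:R + 1 / 2%:R) = 1 / n%:R - 1 / (n%:R * (2%:R * n%:R + 1)) :> rat.
Proof.
have n_gt0 : 0 < n%:R :> rat by rewrite ltr0n.
split; last by field; lra.
(* The zeros give [A] the shape required by [card_ord_range]. *)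
pose A := [set i : 'I_n | (0 <= i < 0 + a)%N].
pose B := [set i : 'I_n | (a <= i < a + b)%N].
have cA : #|A| = a by apply: card_ord_range; lia.
have cB : #|B| = b by apply: card_ord_range; lia.
have dAB : [disjoint A & B].
  by rewrite disjoints_subset; apply/subsetP=> i; rewrite !inE; lia.
have := card_sum_diff_eq0 _ _ _ dAB; rewrite cA cB.
have -> : [set s | sum_diff n A B s == 0] = [set s : 'S_n | D a b s == 0].
  apply/setP=> s; rewrite !inE /D /sum_diff; congr (_ - _ == _).
    by apply: eq_bigl => i; rewrite inE.
  by apply: eq_bigl => i; rewrite inE.
move=> /(_ hb) /(_ ltac:(lia)) le_fact.
rewrite /uniform_Pr card_Sn ler_pdivrMr ?ltr0n ?fact_gt0 //.
rewrite mulrC mulrA mulr1 ler_pdivlMr; last by lra.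
move: le_fact; set k := #|_|; set f := n`!%N => le_fact.
(* Doubling clears the fraction in [n + 1/2]; since [2 b < n], [4 (n - b + 1)] exceeds [2 n + 1]. *)
have : (k * (n.*2).+1 <= f.*2)%N.
  by nia.
rewrite -(ler_nat rat) natrM -!mul2n -natr1 !natrM; lra.
Qed.
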